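(* Let $\phi$ be an LTL formula, $\pi \in \Pi^{*}$ and $i \in \mathbb{N}_{>0}$. Then $\mu_\pi(\phi,i) = \top \leftrightarrow e_\pi(\phi,i) = \top$; $\mu_\pi(\phi,i) = \bot \leftrightarrow e_\pi(\phi,i) = \bot$; and $\mu_\pi(\phi,i) = {?} \leftrightarrow e_\pi(\phi,i) \in \{\top_P, \bot_P, {?}\}$.
   Context: Let $P$ be a finite set of propositions and $\Pi = 2^P$; a finite trace is $\pi = \pi_1\pi_2\cdots \in \Pi^*$ with length $|\pi|$. LTL formulas here are given by $\phi ::= p \mid \neg\phi \mid \phi_1\vee\phi_2 \mid \mathbf{X}\phi \mid \phi_1 \mathbf{U} \phi_2 \mid \mathbf{F}\phi$ with $p\in P$ (no explicit $\top,\bot$ symbols; $\mathbf{X}$ = next, $\mathbf{U}$ = until, $\mathbf{F}$ = eventually, $\mathbf{G}\phi = \neg\mathbf{F}\neg\phi$). Three-valued semantics $\mu_\pi(\phi,i)\in\{\bot,?,\top\}$ with order $\bot<?<\top$, $\neg_3$ swapping $\top,\bot$ and fixing $?$, $\vee_3=\max$, $\wedge_3$ dual: $\mu_\pi(p,i)=\top$ if $i\le|\pi|$ and $p\in\pi_i$, $\bot$ if $i\le|\pi|$ and $p\notin\pi_i$, $?$ otherwise; $\mu_\pi(\neg\phi,i)=\neg_3\mu_\pi(\phi,i)$; $\mu_\pi(\phi_1\vee\phi_2,i)=\mu_\pi(\phi_1,i)\vee_3\mu_\pi(\phi_2,i)$; $\mu_\pi(\mathbf{X}\phi,i)=\mu_\pi(\phi,i+1)$;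 $\mu_\pi(\mathbf{F}\phi,i)=\mu_\pi(\phi,i)\vee_3\mu_\pi(\mathbf{X}\mathbf{F}\phi,i)$ if $i\le|\pi|$ and $\mu_\pi(\phi,i)$ if $i>|\pi|$; $\mu_\pi(\phi_1\mathbf{U}\phi_2,i)=\mu_\pi(\phi_2,i)\vee_3(\mu_\pi(\phi_1,i)\wedge_3\mu_\pi(\mathbf{X}(\phi_1\mathbf{U}\phi_2),i))$ if $i\le|\pi|$ and $\mu_\pi(\phi_2,i)$ if $i>|\pi|$. Counting semantics: $\mathbb{N}_+=\mathbb{N}_0\cup\{\infty,-\}$ with $n<\infty<-$ for all $n\in\mathbb{N}_0$; $a\oplus b=a+b$ if $a,b\in\mathbb{N}_0$, else $\max\{a,b\}$. For pairs: $\mathrm{swap}(s,f)=(f,s)$, $(s,f)\oplus1=(s\oplus1,f\oplus1)$, $(s,f)\sqcup(s',f')=(\min(s,s'),\max(f,f'))$, $(s,f)\sqcap(s',f')=(\max(s,s'),\min(f,f'))$. Define $d_\pi(p,i)=(0,-)$ if $i\le|\pi|$ and $p\in\pi_i$; $(-,0)$ if $i\le|\pi|$ and $p\notin\pi_i$; $(0,0)$ if $i>|\pi|$. $d_\pi(\neg\phi,i)=\mathrm{swap}\,d_\pi(\phi,i)$; $d_\pi(\phi_1\vee\phi_2,i)=d_\pi(\phi_1,i)\sqcup d_\pi(\phi_2,i)$; $d_\pi(\mathbf{X}\phi,i)=d_\pi(\phi,i+1)\oplus1$; $d_\pi(\phi\mathbf{U}\psi,i)=d_\pi(\psi,i)\sqcup(d_\pi(\phi,i)\sqcap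 d_\pi(\mathbf{X}(\phi\mathbf{U}\psi),i))$ if $i\le|\pi|$, and $d_\pi(\psi,i)\sqcup(d_\pi(\phi,i)\sqcap(-,\infty))$ if $i>|\pi|$; $d_\pi(\mathbf{F}\phi,i)=d_\pi(\phi,i)\sqcup d_\pi(\mathbf{X}\mathbf{F}\phi,i)$ if $i\le|\pi|$, and $d_\pi(\phi,i)\sqcup(-,\infty)$ if $i>|\pi|$. Write $d_\pi(\phi,i)=(s_\pi(\phi,i),f_\pi(\phi,i))$. Prediction predicate: $\mathrm{pred}_\pi(\phi,i)=\top$ if $\exists j<i$ with $d_\pi(\phi,j)=(s',-)$ and $s_\pi(\phi,i)\le s'$; $?$ if no $j<i$ has $d_\pi(\phi,j)$ of the form $(s',-)$; $\bot$ if such $j$ exist and $s_\pi(\phi,i)>\max_{0\le j<i}\{s' \mid d_\pi(\phi,j)=(s',-)\}$. Five-valued domain $\bot<\bot_P<?<\top_P<\top$ with $\neg$ swapping $\top\leftrightarrow\bot$, $\top_P\leftrightarrow\bot_P$, fixing $?$; $\vee=\max$, $\wedge$ via De Morgan. Predictive evaluation $e_\pi(\phi,i)$, with $a\le|\pi|-i$, $b_j>|\pi|-i$, $a,b_j\in\mathbb{N}_0$: if $d_\pi(\phi,i)=(a,-)$ then $\top$; if $(b_1,b_2)$ then $\top_P$ if $\mathrm{pred}_\pi(\phi,i)>\mathrm{pred}_\pi(\neg\phi,i)$, $r_\pi(\phi,i)$ if equal, $\bot_P$ if less; if $(b_1,\infty)$ then $\top_P$, $r_\pi(\phi,i)$,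 $\bot_P$ according as $\mathrm{pred}_\pi(\phi,i)$ is $\top$, $?$, $\bot$; if $(\infty,b_1)$ then $e_\pi(\neg\phi,i)$; if $(\infty,\infty)$ then $r_\pi(\phi,i)$; if $(-,a)$ then $\bot$. Auxiliary $r_\pi$: $r_\pi(p,i)=?$; $r_\pi(\neg\phi,i)=\neg e_\pi(\phi,i)$; $r_\pi(\phi_1\vee\phi_2,i)=e_\pi(\phi_1,i)\vee e_\pi(\phi_2,i)$; $r_\pi(\mathbf{X}^n\phi,i)=e_\pi(\phi,i+n)$; $r_\pi(\mathbf{F}\phi,i)=e_\pi(\phi,i)\vee r_\pi(\mathbf{X}\mathbf{F}\phi,i)$ if $i\le|\pi|$, $e_\pi(\phi,i)$ if $i>|\pi|$; $r_\pi(\phi_1\mathbf{U}\phi_2,i)=e_\pi(\phi_2,i)\vee(e_\pi(\phi_2,i)\wedge e_\pi(\mathbf{X}(\phi_1\mathbf{U}\phi_2),i))$ if $i\le|\pi|$, $e_\pi(\phi_2,i)$ if $i>|\pi|$.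
   Formalization: The clause for r(φ1 U φ2, i) with i ≤ |π| is corrected to e(φ2) ∨ (e(φ1) ∧ e(X(φ1 U φ2))); as printed, with e(φ2) twice, the claim fails for π = {p}, φ = p U q, i = 1. Where the equations for e are circular, e is their unique solution. *)

(* Defs.v *)
From HB Require Import structures.
From mathcomp Require Import all_boot all_order.
From mathcomp Require Import zify.

Set Implicit Arguments.
Unset Strict Implicit.
Unset Printing Implicit Defensive.

Import Order.TTheory.

Inductive ltl (P : Type) : Type :=
| Atom of P
| Neg of ltl P
| Or of ltl P & ltl P
| Next of ltl P
| Until of ltl P & ltl P
| Ev of ltl P.

Definition is_next (P : Type) (phi : ltl P) : bool :=
  if phi is Next _ then true else false.

Section Trace.
Variable P : finType.
Implicit Types (pi : seq {set P}) (i : nat).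

(* Positions are 1-based; only applied with 1 <= i <= size pi. *)
Definition letter pi i : {set P} := nth set0 pi i.-1.

(* Computes F by the backward recursion F i = step i (F i.+1) for i <= size pi
   and F i = last i for i > size pi; see backwardE. *)
Fixpoint backward_fuel (T : Type) (step : nat -> T -> T) (last : nat -> T)
    (k i : nat) : T :=
  if k is k'.+1 then step i (backward_fuel step last k' i.+1) else last i.

Definition backward (T : Type) pi (step : nat -> T -> T) (last : nat -> T) i : T :=
  backward_fuel step last ((size pi).+1 - i) i.

Lemma backwardE (T : Type) pi step last i :
  backward pi step last i =
    if i <= size pi then step i (backward pi step last i.+1) else last i :> T.
Proof.
rewrite /backward; case: leqP => hi; first by rewrite subSS subSn.
by have /eqP -> : (size pi).+1 - i == 0 by rewrite subn_eq0.
Qed.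

End Trace.

Inductive verdict3 : Type := Bot3 | Unk3 | Top3.

Definition rank3 (x : verdict3) : nat :=
  match x with Bot3 => 0 | Unk3 => 1 | Top3 => 2 end.
Definition unrank3 (n : nat) : verdict3 :=
  match n with 0 => Bot3 | 1 => Unk3 | _ => Top3 end.
Lemma rank3K : cancel rank3 unrank3. Proof. by case. Qed.
HB.instance Definition _ := Countable.copy verdict3 (can_type rank3K).

Definition le3 (x y : verdict3) := rank3 x <= rank3 y.
Definition lt3 (x y : verdict3) := rank3 x < rank3 y.
Fact lt3_def x y : lt3 x y = (y != x) && le3 x y.
Proof. by case: x; case: y. Qed.
Fact le3_anti : antisymmetric le3. Proof. by case; case. Qed.
Fact le3_trans : transitive le3. Proof. by case; case; case. Qed.
Fact le3_total : total le3. Proof. by case; case. Qed.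
HB.instance Definition _ := Order.isOrder.Build (Order.Disp tt tt) verdict3
  lt3_def (fun _ _ => erefl) (fun _ _ => erefl) le3_anti le3_trans le3_total.

Definition negv3 (x : verdict3) : verdict3 :=
  match x with Bot3 => Top3 | Unk3 => Unk3 | Top3 => Bot3 end.
Definition orv3 (x y : verdict3) : verdict3 := Order.max x y.
Definition andv3 (x y : verdict3) : verdict3 := negv3 (orv3 (negv3 x) (negv3 y)).

Section ThreeValued.
Variables (P : finType) (pi : seq {set P}).
Implicit Types (phi psi : ltl P) (i : nat).

Fixpoint mu phi i : verdict3 :=
  match phi with
  | Atom p =>
      if i <= size pi then (if p \in letter pi i then Top3 else Bot3) else Unk3
  | Neg phi1 => negv3 (mu phi1 i)
  | Or phi1 phi2 => orv3 (mu phi1 i) (mu phi2 i)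
  | Next phi1 => mu phi1 i.+1
  | Until phi1 phi2 =>
      backward pi (fun j x => orv3 (mu phi2 j) (andv3 (mu phi1 j) x)) (mu phi2) i
  | Ev phi1 => backward pi (fun j x => orv3 (mu phi1 j) x) (mu phi1) i
  end.

Lemma mu_Until phi psi i :
  mu (Until phi psi) i =
    if i <= size pi
    then orv3 (mu psi i) (andv3 (mu phi i) (mu (Next (Until phi psi)) i))
    else mu psi i.
Proof. by rewrite {1}/mu -/mu backwardE. Qed.

Lemma mu_Ev phi i :
  mu (Ev phi) i =
    if i <= size pi then orv3 (mu phi i) (mu (Next (Ev phi)) i) else mu phi i.
Proof. by rewrite {1}/mu -/mu backwardE. Qed.

End ThreeValued.

(* Inf and Never stand for the two extra elements oo and - of the domain. *)
Inductive ncount : Type := Fin of nat | Inf | Never.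

Definition code_count (x : ncount) : nat + bool :=
  match x with Fin n => inl n | Inf => inr false | Never => inr true end.
Definition decode_count (y : nat + bool) : ncount :=
  match y with inl n => Fin n | inr false => Inf | inr true => Never end.
Lemma code_countK : cancel code_count decode_count. Proof. by case. Qed.
HB.instance Definition _ := Countable.copy ncount (can_type code_countK).

Definition count_le (x y : ncount) : bool :=
  match x, y with
  | Fin m, Fin n => m <= n
  | Fin _, _ => true
  | Inf, Fin _ => false
  | Inf, _ => true
  | Never, Never => true
  | Never, _ => false
  end.
Definition count_lt (x y : ncount) : bool := ~~ count_le y x.
Fact count_lt_def x y : count_lt x y = (y != x) && count_le x y.
Proof.
rewrite /count_lt -(can_eq code_countK).
case: x => [m||]; case: y => [n||] //=.
by rewrite (inj_eq (@inl_inj _ _)) -ltnNge ltn_neqAle eq_sym.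
Qed.
Fact count_le_anti : antisymmetric count_le.
Proof. by case=> [m||]; case=> [n||] //= /anti_leq ->. Qed.
Fact count_le_trans : transitive count_le.
Proof. by case=> [m||]; case=> [n||]; case=> [q||] //=; apply: leq_trans. Qed.
Fact count_le_total : total count_le.
Proof. by case=> [m||]; case=> [n||] //=; apply: leq_total. Qed.
HB.instance Definition _ := Order.isOrder.Build (Order.Disp tt tt) ncount
  count_lt_def (fun _ _ => erefl) (fun _ _ => erefl)
  count_le_anti count_le_trans count_le_total.

Definition count_add (x y : ncount) : ncount :=
  match x, y with Fin m, Fin n => Fin (m + n) | _, _ => Order.max x y end.

Definition pswap (x : ncount * ncount) : ncount * ncount := (x.2, x.1).
Definition padd1 (x : ncount * ncount) : ncount * ncount :=
  (count_add x.1 (Fin 1), count_add x.2 (Fin 1)).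
Definition pjoin (x y : ncount * ncount) : ncount * ncount :=
  (Order.min x.1 y.1, Order.max x.2 y.2).
Definition pmeet (x y : ncount * ncount) : ncount * ncount :=
  (Order.max x.1 y.1, Order.min x.2 y.2).

Section Counting.
Variables (P : finType) (pi : seq {set P}).
Implicit Types (phi psi : ltl P) (i : nat).

Fixpoint d phi i : ncount * ncount :=
  match phi with
  | Atom p =>
      if i <= size pi
      then (if p \in letter pi i then (Fin 0, Never) else (Never, Fin 0))
      else (Fin 0, Fin 0)
  | Neg phi1 => pswap (d phi1 i)
  | Or phi1 phi2 => pjoin (d phi1 i) (d phi2 i)
  | Next phi1 => padd1 (d phi1 i.+1)
  | Until phi1 phi2 =>
      backward pi (fun j x => pjoin (d phi2 j) (pmeet (d phi1 j) (padd1 x)))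
        (fun j => pjoin (d phi2 j) (pmeet (d phi1 j) (Never, Inf))) i
  | Ev phi1 =>
      backward pi (fun j x => pjoin (d phi1 j) (padd1 x))
        (fun j => pjoin (d phi1 j) (Never, Inf)) i
  end.

Lemma d_Until phi psi i :
  d (Until phi psi) i =
    if i <= size pi
    then pjoin (d psi i) (pmeet (d phi i) (d (Next (Until phi psi)) i))
    else pjoin (d psi i) (pmeet (d phi i) (Never, Inf)).
Proof. by rewrite {1}/d -/d backwardE. Qed.

Lemma d_Ev phi i :
  d (Ev phi) i =
    if i <= size pi then pjoin (d phi i) (d (Next (Ev phi)) i)
    else pjoin (d phi i) (Never, Inf).
Proof. by rewrite {1}/d -/d backwardE. Qed.

(* The earlier positions are j = 1, ..., i-1. In the final branch some s' exists
   and none is >= s, i.e. s exceeds their maximum. *)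
Definition prediction phi i : verdict3 :=
  let ss := [seq (d phi j).1 | j <- index_iota 1 i & (d phi j).2 == Never] in
  if has (fun s' => ((d phi i).1 <= s')%O) ss then Top3
  else if nilp ss then Unk3 else Bot3.

End Counting.

(* Exactly the cases distinguished by is_evaluation below; see d_formP. *)
Variant d_form (l i : nat) : ncount * ncount -> Prop :=
| FormTop a of a + i <= l : d_form l i (Fin a, Never)
| FormBot a of a + i <= l : d_form l i (Never, Fin a)
| FormFinFin b1 b2 of l < b1 + i & l < b2 + i : d_form l i (Fin b1, Fin b2)
| FormFinInf b of l < b + i : d_form l i (Fin b, Inf)
| FormInfFin b of l < b + i : d_form l i (Inf, Fin b)
| FormInfInf : d_form l i (Inf, Inf).

Lemma max_Fin m n : Order.max (Fin m) (Fin n) = Fin (maxn m n).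
Proof.
have [h|h] := leqP m n.
  by rewrite max_r.
by rewrite max_l //; apply: ltnW.
Qed.

Lemma min_Fin m n : Order.min (Fin m) (Fin n) = Fin (minn m n).
Proof.
have [h|h] := leqP m n.
  by rewrite min_l.
by rewrite min_r //; apply: ltnW.
Qed.

Lemma d_form_swap l i x : d_form l i x -> d_form l i (pswap x).
Proof. by case=> *; constructor. Qed.

Lemma d_form_join l i x y : d_form l i x -> d_form l i y -> d_form l i (pjoin x y).
Proof.
case=> [a ha|a ha|b1 b2 h1 h2|b h|b h|];
case=> [a' ha'|a' ha'|b1' b2' h1' h2'|b' h'|b' h'|];
  rewrite /pjoin /= ?max_Fin ?min_Fin; constructor; lia.
Qed.

Lemma d_form_meet l i x y : d_form l i x -> d_form l i y -> d_form l i (pmeet x y).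
Proof.
move=> hx hy; rewrite -[pmeet x y]/(pswap (pjoin (pswap x) (pswap y))).
by apply/d_form_swap/d_form_join; apply: d_form_swap.
Qed.

Lemma d_form_add1 l i x : d_form l i.+1 x -> d_form l i (padd1 x).
Proof. by case=> *; rewrite /padd1 /=; constructor; lia. Qed.

Lemma d_form_join_end l i x : l < i -> d_form l i x -> d_form l i (pjoin x (Never, Inf)).
Proof. by move=> hi; case=> *; try lia; rewrite /pjoin; constructor; lia. Qed.

Lemma d_form_until_end l i x y : l < i -> d_form l i x -> d_form l i y ->
  d_form l i (pjoin y (pmeet x (Never, Inf))).
Proof.
move=> hi; case=> [a ha|a ha|b1 b2 h1 h2|b h|b h|];
case=> [a' ha'|a' ha'|b1' b2' h1' h2'|b' h'|b' h'|]; try lia;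
  rewrite /pmeet /pjoin /= ?max_Fin ?min_Fin; constructor; lia.
Qed.

Lemma d_formP (P : finType) (pi : seq {set P}) (phi : ltl P) i :
  d_form (size pi) i (d pi phi i).
Proof.
elim: phi i => [p|phi IH|phi IHphi psi IHpsi|phi IH|phi IHphi psi IHpsi|phi IH] i.
- by rewrite /=; case: leqP => h; [case: ifP|]; constructor.
- exact: d_form_swap.
- exact: d_form_join.
- exact: d_form_add1.
- have key k : forall j, size pi < k + j -> d_form (size pi) j (d pi (Until phi psi) j).
    elim: k => [|k IHk] j hk; rewrite d_Until; case: leqP => hj; try lia;
      try exact: d_form_until_end.
    apply/d_form_join/d_form_meet => //; apply: d_form_add1; apply: IHk; lia.
  by apply: (key (size pi).+1); lia.
- have key k : forall j, size pi < k + j -> d_form (size pi) j (d pi (Ev phi) j).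
    elim: k => [|k IHk] j hk; rewrite d_Ev; case: leqP => hj; try lia;
      try exact: d_form_join_end.
    apply/d_form_join => //; apply: d_form_add1; apply: IHk; lia.
  by apply: (key (size pi).+1); lia.
Qed.

Inductive verdict5 : Type := Bot5 | BotP | Unk5 | TopP | Top5.

Definition rank5 (x : verdict5) : nat :=
  match x with Bot5 => 0 | BotP => 1 | Unk5 => 2 | TopP => 3 | Top5 => 4 end.
Definition unrank5 (n : nat) : verdict5 :=
  match n with 0 => Bot5 | 1 => BotP | 2 => Unk5 | 3 => TopP | _ => Top5 end.
Lemma rank5K : cancel rank5 unrank5. Proof. by case. Qed.
HB.instance Definition _ := Countable.copy verdict5 (can_type rank5K).

Definition le5 (x y : verdict5) := rank5 x <= rank5 y.
Definition lt5 (x y : verdict5) := rank5 x < rank5 y.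
Fact lt5_def x y : lt5 x y = (y != x) && le5 x y.
Proof. by case: x; case: y. Qed.
Fact le5_anti : antisymmetric le5. Proof. by case; case. Qed.
Fact le5_trans : transitive le5. Proof. by case; case; case. Qed.
Fact le5_total : total le5. Proof. by case; case. Qed.
HB.instance Definition _ := Order.isOrder.Build (Order.Disp tt tt) verdict5
  lt5_def (fun _ _ => erefl) (fun _ _ => erefl) le5_anti le5_trans le5_total.

Definition negv5 (x : verdict5) : verdict5 :=
  match x with
  | Bot5 => Top5 | BotP => TopP | Unk5 => Unk5 | TopP => BotP | Top5 => Bot5
  end.
Definition orv5 (x y : verdict5) : verdict5 := Order.max x y.
Definition andv5 (x y : verdict5) : verdict5 := negv5 (orv5 (negv5 x) (negv5 y)).

Section Evaluation.
Variables (P : finType) (pi : seq {set P}).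
Implicit Types (phi psi : ltl P) (i a b n : nat) (e r : ltl P -> nat -> verdict5).

(* The defining equations of the pair (e, r). They are not a well-founded
   recursion: when d phi i = (oo, b) and the prediction for Neg phi is
   inconclusive, e phi i = e (Neg phi) i = r (Neg phi) i = negv5 (e phi i).
   They nevertheless have exactly one solution at positions i > 0, see
   evaluation_exists and evaluation_unique.
   The bounds a <= |pi| - i and b > |pi| - i are over the integers.
   In reval_Until the second disjunct takes the first operand of U, as mu and d
   do. With e psi in its place r would absorb to e psi and a merely pending
   until would evaluate to Bot5. *)
Record is_evaluation e r : Prop := IsEvaluation {
  eval_top : forall phi i a, 0 < i -> a + i <= size pi ->
    d pi phi i = (Fin a, Never) -> e phi i = Top5;
  eval_fin_fin : forall phi i b1 b2, 0 < i ->
    size pi < b1 + i -> size pi < b2 + i ->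
    d pi phi i = (Fin b1, Fin b2) ->
    e phi i =
      if (prediction pi (Neg phi) i < prediction pi phi i)%O then TopP
      else if prediction pi phi i == prediction pi (Neg phi) i then r phi i
      else BotP;
  eval_fin_inf : forall phi i b1, 0 < i -> size pi < b1 + i ->
    d pi phi i = (Fin b1, Inf) ->
    e phi i =
      match prediction pi phi i with
      | Top3 => TopP | Unk3 => r phi i | Bot3 => BotP
      end;
  eval_inf_fin : forall phi i b1, 0 < i -> size pi < b1 + i ->
    d pi phi i = (Inf, Fin b1) -> e phi i = e (Neg phi) i;
  eval_inf_inf : forall phi i, 0 < i ->
    d pi phi i = (Inf, Inf) -> e phi i = r phi i;
  eval_bot : forall phi i a, 0 < i -> a + i <= size pi ->
    d pi phi i = (Never, Fin a) -> e phi i = Bot5;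
  reval_Atom : forall p i, 0 < i -> r (Atom p) i = Unk5;
  reval_Neg : forall phi i, 0 < i -> r (Neg phi) i = negv5 (e phi i);
  reval_Or : forall phi psi i, 0 < i ->
    r (Or phi psi) i = orv5 (e phi i) (e psi i);
  (* X^n phi with n >= 1 maximal: phi itself does not start with X. *)
  reval_Next : forall phi i n, 0 < i -> 0 < n -> ~~ is_next phi ->
    r (iter n (@Next P) phi) i = e phi (i + n);
  reval_Until : forall phi psi i, 0 < i ->
    r (Until phi psi) i =
      if i <= size pi
      then orv5 (e psi i) (andv5 (e phi i) (e (Next (Until phi psi)) i))
      else e psi i;
  reval_Ev : forall phi i, 0 < i ->
    r (Ev phi) i =
      if i <= size pi then orv5 (e phi i) (r (Next (Ev phi)) i) else e phi i
}.

(* A solution by structural recursion: e_of phi i x is the value of e phi i when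
   r phi i = x, the circular case taking the only fixpoint Unk5 of negv5. *)
Let e_of phi i (x : verdict5) : verdict5 :=
  match d pi phi i with
  | (_, Never) => Top5
  | (Never, _) => Bot5
  | (Fin _, Fin _) =>
      if (prediction pi (Neg phi) i < prediction pi phi i)%O then TopP
      else if prediction pi phi i == prediction pi (Neg phi) i then x else BotP
  | (Fin _, Inf) =>
      match prediction pi phi i with Top3 => TopP | Unk3 => x | Bot3 => BotP end
  | (Inf, Fin _) =>
      match prediction pi (Neg phi) i with
      | Top3 => TopP | Unk3 => Unk5 | Bot3 => BotP
      end
  | (Inf, Inf) => x
  end.

Let r0 := fix r0 phi i : verdict5 :=
  match phi with
  | Atom _ => Unk5
  | Neg phi1 => negv5 (e_of phi1 i (r0 phi1 i))
  | Or phi1 phi2 => orv5 (e_of phi1 i (r0 phi1 i)) (e_of phi2 i (r0 phi2 i))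
  | Next phi1 =>
      if is_next phi1 then r0 phi1 i.+1 else e_of phi1 i.+1 (r0 phi1 i.+1)
  | Until phi1 phi2 =>
      backward pi
        (fun j x => orv5 (e_of phi2 j (r0 phi2 j))
           (andv5 (e_of phi1 j (r0 phi1 j))
              (e_of (Next phi) j (e_of phi j.+1 x))))
        (fun j => e_of phi2 j (r0 phi2 j)) i
  | Ev phi1 =>
      backward pi (fun j x => orv5 (e_of phi1 j (r0 phi1 j)) (e_of phi j.+1 x))
        (fun j => e_of phi1 j (r0 phi1 j)) i
  end.

Let e0 phi i := e_of phi i (r0 phi i).

Let r0_Next phi i n : 0 < n -> ~~ is_next phi ->
  r0 (iter n (@Next P) phi) i = e0 phi (i + n).
Proof.
case: n => // n _ nphi; elim: n i => [|n IH] i.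
  by rewrite addn1 /= (negbTE nphi).
by rewrite -addSnnS -IH.
Qed.

Let r0_Until phi psi i :
  r0 (Until phi psi) i =
    if i <= size pi
    then orv5 (e0 psi i) (andv5 (e0 phi i) (e0 (Next (Until phi psi)) i))
    else e0 psi i.
Proof. by rewrite {1}/r0 -/r0 backwardE. Qed.

Let r0_Ev phi i :
  r0 (Ev phi) i =
    if i <= size pi then orv5 (e0 phi i) (r0 (Next (Ev phi)) i) else e0 phi i.
Proof. by rewrite {1}/r0 -/r0 backwardE. Qed.

Let d_Neg phi i : d pi (Neg phi) i = pswap (d pi phi i). Proof. by []. Qed.

Lemma evaluation_exists :
  {er : (ltl P -> nat -> verdict5) * (ltl P -> nat -> verdict5) |
    is_evaluation er.1 er.2}.
Proof.
exists (e0, r0); split => /=.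
- by move=> phi i a _ _ E; rewrite /e0 /e_of E.
- by move=> phi i b1 b2 _ _ _ E; rewrite /e0 /e_of E.
- by move=> phi i b1 _ _ E; rewrite /e0 /e_of E.
- move=> phi i b1 _ _ E; rewrite /e0 /e_of d_Neg E /=.
  by case Ep: (prediction pi (Neg phi) i) => //; rewrite /e_of E Ep.
- by move=> phi i _ E; rewrite /e0 /e_of E.
- by move=> phi i a _ _ E; rewrite /e0 /e_of E.
- by [].
- by [].
- by [].
- by move=> phi i n _; apply: r0_Next.
- by move=> phi psi i _; apply: r0_Until.
- by move=> phi i _; apply: r0_Ev.
Qed.

Lemma evaluation_unique e r e' r' : is_evaluation e r -> is_evaluation e' r' ->
  forall phi i, 0 < i -> e phi i = e' phi i /\ r phi i = r' phi i.
Proof.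
suff H e1 r1 : is_evaluation e1 r1 ->
    forall phi i, 0 < i -> e1 phi i = e0 phi i /\ r1 phi i = r0 phi i.
  move=> E E' phi i hi; have [-> ->] := H _ _ E phi i hi.
  by have [-> ->] := H _ _ E' phi i hi.
move=> E.
have eE phi i : 0 < i -> r1 phi i = r0 phi i -> e1 phi i = e0 phi i.
  move=> hi hr; rewrite /e0 -hr /e_of.
  case hd: _ / (d_formP pi phi i) => [a ha|a ha|b1 b2 h1 h2|b h|b h|].
  - by rewrite (eval_top E hi ha hd).
  - by rewrite (eval_bot E hi ha hd).
  - by rewrite (eval_fin_fin E hi h1 h2 hd).
  - by rewrite (eval_fin_inf E hi h hd).
  - have hN : d pi (Neg phi) i = (Fin b, Inf) by rewrite d_Neg hd.
    have e1N := eval_inf_fin E hi h hd.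
    move: (eval_fin_inf E hi h hN); rewrite -e1N (reval_Neg E) //.
    by case: prediction => //; case: (e1 phi i).
  - by rewrite (eval_inf_inf E hi hd).
suff rE phi i : 0 < i -> r1 phi i = r0 phi i by move=> phi i hi; split; auto.
elim: phi i => [p|phi IH|phi IHphi psi IHpsi|phi IH|phi IHphi psi IHpsi|phi IH] i hi.
- by rewrite (reval_Atom E).
- by rewrite (reval_Neg E) //= (eE _ _ hi (IH _ hi)).
- by rewrite (reval_Or E) //= !eE //; auto.
- have [n [psi [npsi phiE]]] : exists n psi, ~~ is_next psi /\ phi = iter n (@Next P) psi.
    elim: {IH} phi => [p|phi _|phi _ psi _|phi [n [psi [? ->]]]|phi _ psi _|phi _];
      by [exists n.+1, psi | eexists 0, _; split; last by []].
  rewrite phiE -iterS (reval_Next E) // r0_Next //.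
  case: n phiE => [|n] phiE; first by rewrite addn1 eE // -[psi]/(iter 0 (@Next P) psi) -phiE IH.
  have := IH i.+1 isT; rewrite phiE (reval_Next E) // r0_Next //.
  by rewrite addSnnS.
- have key k : forall j, 0 < j -> size pi < k + j ->
      r1 (Until phi psi) j = r0 (Until phi psi) j.
    elim: k => [|k IHk] j hj hk; rewrite (reval_Until E) // r0_Until.
      by rewrite leqNgt hk /= eE // IHpsi.
    case: ifP => // hjs; rewrite (eE _ _ hj (IHpsi _ hj)) // (eE _ _ hj (IHphi _ hj)).
    congr (orv5 _ (andv5 _ _)); apply: (eE) => //.
    rewrite (reval_Next E (phi := Until phi psi) (n := 1)) //.
    rewrite (r0_Next (phi := Until phi psi) _ (n := 1)) // addn1.
    by apply: eE => //; apply: IHk => //; rewrite addnS.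
  by apply: (key (size pi).+1) => //; lia.
- have key k : forall j, 0 < j -> size pi < k + j ->
      r1 (Ev phi) j = r0 (Ev phi) j.
    elim: k => [|k IHk] j hj hk; rewrite (reval_Ev E) // r0_Ev.
      by rewrite leqNgt hk /= eE // IH.
    case: ifP => // hjs; rewrite (eE _ _ hj (IH _ hj)) //.
    congr orv5.
    rewrite (reval_Next E (phi := Ev phi) (n := 1)) //.
    rewrite (r0_Next (phi := Ev phi) _ (n := 1)) // addn1.
    by apply: eE => //; apply: IHk => //; rewrite addnS.
  by apply: (key (size pi).+1) => //; lia.
Qed.

Definition evaluation : ltl P -> nat -> verdict5 := (sval evaluation_exists).1.
Definition raux : ltl P -> nat -> verdict5 := (sval evaluation_exists).2.

Lemma evaluationP : is_evaluation evaluation raux.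
Proof. exact: svalP evaluation_exists. Qed.

End Evaluation.

(* Main.v *)
Require Import Defs.
From mathcomp Require Import all_boot all_order.
From mathcomp Require Import zify.

(** Both semantics project onto the same three values: a counting pair is
    decided exactly when one component is [Never], and this projection turns
    the operations on pairs into the connectives of [mu], so [mu] is the
    projection of [d].  Forgetting predictions in the five-valued domain is
    also a morphism; the evaluation copies decided pairs, and on undecided ones
    it either predicts or calls [raux], which by structural induction stays
    undecided. *)

Set Implicit Arguments.
Unset Strict Implicit.
Unset Printing Implicit Defensive.

Definition verdict_of_pair (x : ncount * ncount) : verdict3 :=
  match x with
  | (_, Never) => Top3
  | (Never, _) => Bot3
  | _ => Unk3
  end.

Definition unpredict (x : verdict5) : verdict3 :=
  match x with
  | Top5 => Top3
  | Bot5 => Bot3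
  | _ => Unk3
  end.

Lemma unpredict_neg x : unpredict (negv5 x) = negv3 (unpredict x).
Proof. by case: x. Qed.

Lemma unpredict_or x y : unpredict (orv5 x y) = orv3 (unpredict x) (unpredict y).
Proof. by case: x; case: y. Qed.

Lemma unpredict_and x y :
  unpredict (andv5 x y) = andv3 (unpredict x) (unpredict y).
Proof. by case: x; case: y. Qed.

(* Well-formedness excludes the contradictory pair [(Never, Never)]. *)
Lemma verdict_of_swap l i x : d_form l i x ->
  verdict_of_pair (pswap x) = negv3 (verdict_of_pair x).
Proof. by case. Qed.

(** [Never] is the greatest count: a maximum is [Never] as soon as one argument is, a minimum only
    when both are. *)
Lemma verdict_of_join l i x y : d_form l i x -> d_form l i y ->
  verdict_of_pair (pjoin x y) = orv3 (verdict_of_pair x) (verdict_of_pair y).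
Proof.
by case=> [a ha|a ha|b1 b2 h1 h2|b h|b h|];
   case=> [a' ha'|a' ha'|b1' b2' h1' h2'|b' h'|b' h'|];
   rewrite /pjoin /= ?max_Fin ?min_Fin.
Qed.

Lemma verdict_of_meet l i x y : d_form l i x -> d_form l i y ->
  verdict_of_pair (pmeet x y) = andv3 (verdict_of_pair x) (verdict_of_pair y).
Proof.
move=> hx hy; rewrite -[pmeet x y]/(pswap (pjoin (pswap x) (pswap y))).
have sx := d_form_swap hx; have sy := d_form_swap hy.
rewrite (verdict_of_swap (d_form_join sx sy)) (verdict_of_join sx sy).
by rewrite (verdict_of_swap hx) (verdict_of_swap hy).
Qed.

Lemma verdict_of_add1 x : verdict_of_pair (padd1 x) = verdict_of_pair x.
Proof. by case: x => [[?||] [?||]]. Qed.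

(** [(Never, Inf)] projects to [Bot3], neutral for [orv3]; it lies outside [d_form], hence the
    direct check. *)
Lemma verdict_of_join_end x :
  verdict_of_pair (pjoin x (Never, Inf)) = verdict_of_pair x.
Proof. by case: x => [[?||] [?||]]. Qed.

(** The inner meet has first component [Never] and second at most [Inf], so it too projects to
    [Bot3]. *)
Lemma verdict_of_until_end l i x y : d_form l i x -> d_form l i y ->
  verdict_of_pair (pjoin y (pmeet x (Never, Inf))) = verdict_of_pair y.
Proof.
by case=> [a ha|a ha|b1 b2 h1 h2|b h|b h|];
   case=> [a' ha'|a' ha'|b1' b2' h1' h2'|b' h'|b' h'|];
   rewrite /pmeet /pjoin /= ?max_Fin ?min_Fin.
Qed.

(** Mirrors the recursion of [backward] when [n] is the trace length. *)
Lemma backward_ind n (Q : nat -> Prop) :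
  (forall i, n < i -> Q i) -> (forall i, i <= n -> Q i.+1 -> Q i) ->
  forall i, Q i.
Proof.
move=> Qend Qstep i; have [k] : exists k, n < k + i by exists n.+1; lia.
elim: k i => [|k IH] i hk; first exact: Qend.
by have [/Qstep|/Qend] := leqP i n; [apply; apply: IH; lia|].
Qed.

Section Agreement.
Variables (P : finType) (pi : seq {set P}).
Implicit Types (phi psi : ltl P) (i : nat).

Lemma mu_counting phi i : mu pi phi i = verdict_of_pair (d pi phi i).
Proof.
elim: phi i => [p|phi IH|phi IHphi psi IHpsi|phi IH|phi IHphi psi IHpsi|phi IH] i.
- by rewrite /=; case: ifP => // _; case: ifP.
- by rewrite [RHS](verdict_of_swap (d_formP pi phi i)) -IH.
- rewrite [RHS](verdict_of_join (d_formP pi phi i) (d_formP pi psi i)).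
  by rewrite -IHphi -IHpsi.
- by rewrite [RHS]verdict_of_add1 -IH.
- elim/(@backward_ind (size pi)): i => i hi.
    rewrite mu_Until d_Until leqNgt hi.
    by rewrite (verdict_of_until_end (d_formP pi phi i) (d_formP pi psi i)) -IHpsi.
  move=> IHi; rewrite mu_Until d_Until hi.
  have hX := d_formP pi (Next (Until phi psi)) i.
  rewrite (verdict_of_join (d_formP pi psi i) (d_form_meet (d_formP pi phi i) hX)).
  rewrite (verdict_of_meet (d_formP pi phi i) hX) -IHphi -IHpsi.
  by rewrite [mu _ (Next _) _]IHi -verdict_of_add1.
- elim/(@backward_ind (size pi)): i => i hi.
    by rewrite mu_Ev d_Ev leqNgt hi verdict_of_join_end -IH.
  move=> IHi; rewrite mu_Ev d_Ev hi.
  rewrite (verdict_of_join (d_formP pi phi i) (d_formP pi (Next (Ev phi)) i)) -IH.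
  by rewrite [mu _ (Next _) _]IHi -verdict_of_add1.
Qed.

Variables e r : ltl P -> nat -> verdict5.
Hypothesis E : is_evaluation pi e r.

(** The equation for [r] treats a maximal block of [Next] at once; structural induction needs one
    [Next] at a time. *)
Lemma reval_Next1 phi i : 0 < i ->
  r (Next phi) i = if is_next phi then r phi i.+1 else e phi i.+1.
Proof.
move=> hi; case: ifPn => [|nphi]; last first.
  by rewrite -[Next phi]/(iter 1 (@Next P) phi) (reval_Next E) // addn1.
have [n [psi [npsi ->]]] : exists n psi, ~~ is_next psi /\ phi = iter n (@Next P) psi.
  elim: phi => [p|phi _|phi _ psi _|phi [n [psi [? ->]]]|phi _ psi _|phi _];
    by [exists n.+1, psi | eexists 0, _; split; last by []].
case: n => [|n] nxt; first by rewrite nxt in npsi.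
by rewrite -iterS !(reval_Next E) // addSnnS.
Qed.

(** Decided pairs fix [e] without consulting [r], so [r] has to be controlled only where [mu] is
    [Unk3]. *)
Lemma unpredict_eval phi i : 0 < i ->
  (mu pi phi i = Unk3 -> unpredict (r phi i) = Unk3) ->
  unpredict (e phi i) = mu pi phi i.
Proof.
rewrite mu_counting => hi.
case hd: _ / (d_formP pi phi i) => [a ha|a ha|b1 b2 h1 h2|b h|b h|] //= hr.
- by rewrite (eval_top E hi ha hd).
- by rewrite (eval_bot E hi ha hd).
- rewrite (eval_fin_fin E hi h1 h2 hd); case: ifP => // _; case: ifP => // _.
  exact: hr.
- by rewrite (eval_fin_inf E hi h hd); case: prediction => //; apply: hr.
- (* With no prediction, [e phi i = negv5 (e phi i)]. *)
  have hN : d pi (Neg phi) i = (Fin b, Inf) by rewrite /= hd.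
  have eN := eval_inf_fin E hi h hd.
  move: (eval_fin_inf E hi h hN); rewrite -eN (reval_Neg E) //.
  by case: prediction => [||] //; case: (e phi i).
- by rewrite (eval_inf_inf E hi hd) hr.
Qed.

(** Only the undecided case can hold: [r] is [Unk5] on every atom, even where [mu] is decided. *)
Lemma unpredict_reval phi i : 0 < i ->
  mu pi phi i = Unk3 -> unpredict (r phi i) = Unk3.
Proof.
elim: phi i => [p|phi IH|phi IHphi psi IHpsi|phi IH|phi IHphi psi IHpsi|phi IH] i hi.
- by rewrite (reval_Atom E).
- have eE := unpredict_eval hi (IH i hi).
  by rewrite (reval_Neg E) // unpredict_neg eE.
- have ephi := unpredict_eval hi (IHphi i hi).
  have epsi := unpredict_eval hi (IHpsi i hi).
  by rewrite (reval_Or E) // unpredict_or ephi epsi.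
- rewrite reval_Next1 //= => hmu; case: ifP => _; first exact: IH.
  by rewrite unpredict_eval //; apply: IH.
- elim/(@backward_ind (size pi)): i hi => i his.
    move=> hi; have epsi := unpredict_eval hi (IHpsi i hi).
    by rewrite mu_Until (reval_Until E) // leqNgt his /= epsi.
  move=> IHi hi; have ephi := unpredict_eval hi (IHphi i hi).
  have epsi := unpredict_eval hi (IHpsi i hi).
  rewrite mu_Until (reval_Until E) // his unpredict_or unpredict_and ephi epsi.
  (* [Next (Until phi psi)] is not a subformula: its [r] is [e] of the until at [i.+1], which the
     backward hypothesis covers. *)
  rewrite unpredict_eval // reval_Next1 //= => hmu.
  by rewrite unpredict_eval //; apply: IHi.
- elim/(@backward_ind (size pi)): i hi => i his.
    move=> hi; have ephi := unpredict_eval hi (IH i hi).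
    by rewrite mu_Ev (reval_Ev E) // leqNgt his /= ephi.
  move=> IHi hi; have ephi := unpredict_eval hi (IH i hi).
  rewrite mu_Ev (reval_Ev E) // his unpredict_or ephi reval_Next1 //=.
  by rewrite unpredict_eval //; apply: IHi.
Qed.

End Agreement.

Theorem theorem2 (P : finType) (phi : ltl P) (pi : seq {set P}) (i : nat)
    (hi : 0 < i) :
  [/\ mu pi phi i = Top3 <-> evaluation pi phi i = Top5,
      mu pi phi i = Bot3 <-> evaluation pi phi i = Bot5
    & mu pi phi i = Unk3 <-> evaluation pi phi i \in [:: TopP; BotP; Unk5]].
Proof.
have E := evaluationP pi.
(* The three claims now describe the fibres of [unpredict]. *)
rewrite -(unpredict_eval E hi (unpredict_reval E hi)).
by case: (evaluation pi phi i).
Qed.
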